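(* The approximation ratio of the Random Dictatorship (RD) mechanism is $3/2$.
   Context: Setting: a finite nonempty set $N$ of $n$ agents and two facilities $1,2$. Agent $i$ has a position $x_i\in[0,1]$ and an approval preference $t_i=(t_{i1},t_{i2})\in\{0,1\}^2$ ($t_{ij}=1$ iff $i$ approves facility $j$); every agent approves one of the two facilities or both. An instance is $I=(\mathbf{x},\mathbf{t})$ with $\mathbf{x}=(x_i)_{i\in N}$, $\mathbf{t}=(t_i)_{i\in N}$. If facility $j$ is located at $y\in[0,1]$ (a single facility is located), agent $i$ has utility $u_i(j,y|I)=t_{ij}(1-|x_i-y|)$; the social welfare is $W(j,y|I)=\sum_{i\in N}u_i(j,y|I)$ and $W^*(I)=\max_{(j,y)}W(j,y|I)$. The optimal facility for $I$ is a facility $j$ with $\max_y W(j,y|I)=W^*(I)$. A randomized mechanism $M$ maps each instance to a probability distribution over outcomes $(j,y)\in\{1,2\}\times[0,1]$; its approximation ratio is $\rho(M)=\sup_I W^*(I)/W(M(I)|I)$ over all instances (with any number of agents), where $W(M(I)|I)$ is the expected social welfare. RD mechanism: choose an agent $i$ uniformly at random. If agent $i$ approves a single facility $j$, locate $j$ at $x_i$. If agent $i$ approves both facilities, locate the optimal one at $x_i$. *)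

(* Defs.v *)
From HB Require Import structures.
From mathcomp Require Import all_boot all_order all_algebra.
From mathcomp Require Import all_classical all_reals all_analysis.

Set Implicit Arguments.
Unset Strict Implicit.
Unset Printing Implicit Defensive.

Import Order.TTheory GRing.Theory Num.Theory.
Import numFieldNormedType.Exports.

Local Open Scope classical_set_scope.
Local Open Scope ring_scope.

(* The two facilities are the elements of bool, which carries the discrete
   sigma-algebra. *)
Notation facility := bool.
Definition facility1 : facility := false.
Definition facility2 : facility := true.

(* [approves i j] is t_ij. *)
Record instance (R : realType) := Instance {
  agent : finType;
  position : agent -> R;
  approves : agent -> facility -> bool;
  agent_nonempty : (0 < #|agent|)%N;
  position01 : forall i, 0 <= position i <= 1;
  approves_some : forall i, approves i facility1 || approves i facility2
}.

Arguments agent {R}.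
Arguments position {R} _ _.
Arguments approves {R} _ _ _.

(* The locations of outcomes range over all of R, so that the Borel
   sigma-algebra of R can be used; the constraint that the location lies in
   [0, 1] is the set [feasible]. *)
Notation outcome R := (facility * measurableTypeR R)%type.

Section welfare.
Context {R : realType}.
Implicit Type I : instance R.

Definition feasible : set (outcome R) := [set: facility] `*` `[0, 1].

Definition utility I (i : agent I) (o : outcome R) : R :=
  (approves I i o.1)%:R * (1 - `|position I i - o.2|).

Definition welfare I (o : outcome R) : R := \sum_(i : agent I) utility i o.

(* max_y W(j, y | I); the supremum is attained, see facility_welfareP. *)
Definition facility_welfare I (j : facility) : R :=
  sup [set welfare I (j, y) | y in `[0, 1]].

(* W^*(I); the supremum is attained, see opt_welfareP. *)
Definition opt_welfare I : R := sup (welfare I @` feasible).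

Definition optimal_facility I (j : facility) : Prop :=
  facility_welfare I j = opt_welfare I.

Lemma sup_attained (A : set R) (m : R) : A m -> ubound A m -> sup A = m.
Proof.
move=> Am Um; apply/eqP; rewrite eq_le; apply/andP; split.
  by apply: ge_sup => //; exists m.
by apply: ub_le_sup => //; exists m.
Qed.

Lemma continuous_welfare I j : continuous (fun y : R => welfare I (j, y)).
Proof.
rewrite /welfare /utility /=.
apply: continuous_big => [|i _ y]; first exact: add_continuous.
apply: cvgM; first exact: cvg_cst.
apply: cvgB; first exact: cvg_cst.
by apply: cvg_norm; apply: cvgB; [exact: cvg_cst|exact: cvg_id].
Qed.

Lemma facility_welfareP I j : exists y : R,
  [/\ 0 <= y <= 1, welfare I (j, y) = facility_welfare I j &
      forall z : R, 0 <= z <= 1 -> welfare I (j, z) <= facility_welfare I j].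
Proof.
have [y y01 ymax] : exists2 y : R, y \in `[0, 1] & forall z : R,
    z \in `[0, 1] -> welfare I (j, z) <= welfare I (j, y).
  apply: EVT_max => //.
  by apply: continuous_subspaceT; exact: continuous_welfare.
have -> : facility_welfare I j = welfare I (j, y).
  by apply: sup_attained => [|_ [z /= z01 <-]]; [exists y|exact: ymax].
by exists y; split => // z z01; apply: ymax; rewrite in_itv.
Qed.

Lemma opt_welfareP I : exists2 o, feasible o &
  welfare I o = opt_welfare I /\
  forall o', feasible o' -> welfare I o' <= opt_welfare I.
Proof.
have [y1 [y1P e1 m1]] := facility_welfareP I facility1.
have [y2 [y201 e2 m2]] := facility_welfareP I facility2.
have [w fw wmax] : exists2 o, feasible o &
    forall o', feasible o' -> welfare I o' <= welfare I o.
  have [le12|/ltW le21] :=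
    leP (facility_welfare I facility1) (facility_welfare I facility2).
    exists (facility2, y2); first by split => //=; rewrite in_itv.
    move=> [[] z] [_ /=]; rewrite in_itv /= => z01; rewrite e2 ?m2//.
    exact: le_trans (m1 _ z01) le12.
  exists (facility1, y1); first by split => //=; rewrite in_itv.
  move=> [[] z] [_ /=]; rewrite in_itv /= => z01; rewrite e1 ?m1//.
  exact: le_trans (m2 _ z01) le21.
exists w => //.
have -> : opt_welfare I = welfare I w; last by [].
by apply: sup_attained => [|_ [w' fw' <-]]; [exists w|exact: wmax].
Qed.

Lemma optimal_facility_exists I : exists j, optimal_facility I j.
Proof.
have [[j y] [_ /=]] := opt_welfareP I; rewrite in_itv /= => y01 [wE wmax].
have [z [z01 zE zmax]] := facility_welfareP I j.
exists j; apply/eqP; rewrite eq_le -{1}zE -wE zmax// wE wmax//.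
Qed.

End welfare.

Record mechanism (R : realType) := Mechanism {
  mechanism_dist :> instance R -> probability (outcome R) R;
  mechanism_feasible : forall I, mechanism_dist I feasible = 1%E
}.

Definition expected_welfare (R : realType) (M : mechanism R) (I : instance R) :
  \bar R := 'E_(M I)[welfare I].

(* The quotient is taken in the extended reals, where 0^-1 = +oo. *)
Definition approximation_ratio (R : realType) (M : mechanism R) : \bar R :=
  ereal_sup [set r | exists I : instance R,
    r = ((opt_welfare I)%:E / expected_welfare M I)%E].

Section RD.
Context {R : realType}.
(* [opt] selects the optimal facility of each instance (breaking ties when both
   are optimal). *)
Variable opt : instance R -> facility.
Implicit Type I : instance R.

Definition RD_outcome I (i : agent I) : outcome R :=
  (if approves I i facility1 && approves I i facility2 then opt I
   else if approves I i facility1 then facility1 else facility2,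
   position I i).

Section distribution.
Local Open Scope ereal_scope.
Variable I : instance R.

(* The law of [RD_outcome i] for i uniform in [agent I]. *)
Definition RD_dist (A : set (outcome R)) : \bar R :=
  (#|agent I|%:R^-1)%:E * \sum_(i : agent I) \d_(RD_outcome i) A.

Let RD_dist0 : RD_dist set0 = 0.
Proof. by rewrite /RD_dist big1 ?mule0// => i _; rewrite measure0. Qed.

Let RD_dist_ge0 A : 0 <= RD_dist A.
Proof.
apply: mule_ge0; first by rewrite lee_fin invr_ge0.
by apply: sume_ge0 => i _; exact: measure_ge0.
Qed.

Let RD_dist_sigma_additive : semi_sigma_additive RD_dist.
Proof.
move=> F mF tF mUF.
have {}mass B : RD_dist B =
    \sum_(i : agent I) mscale ((#|agent I|%:R^-1 : R)%:nng)%R \d_(RD_outcome i) B.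
  by rewrite /RD_dist ge0_sume_distrr// => i _; exact: measure_ge0.
rewrite [X in _ --> X](_ : _ =
    lim ((fun n => \sum_(0 <= i < n) RD_dist (F i)) @ \oo)).
  by apply: is_cvg_ereal_nneg_natsum => k _; exact: RD_dist_ge0.
rewrite mass (eq_eseriesr (fun n _ => mass (F n))) nneseries_sum//.
by apply: eq_bigr => i _; exact: measure_semi_bigcup.
Qed.

HB.instance Definition _ := isMeasure.Build _ _ _ RD_dist
  RD_dist0 RD_dist_ge0 RD_dist_sigma_additive.

Lemma RD_dist1 A : (forall i, A (@RD_outcome I i)) -> RD_dist A = 1.
Proof.
move=> HA; rewrite /RD_dist (eq_bigr (fun=> 1%:E)); last first.
  by move=> i _; rewrite diracE mem_set.
rewrite sumEFin sumr_const -EFinM mulVf// pnatr_eq0 -lt0n.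
exact: agent_nonempty.
Qed.

HB.instance Definition _ := Measure_isProbability.Build _ _ _ RD_dist
  (RD_dist1 (fun=> Logic.I)).

End distribution.

Lemma RD_feasible I : RD_dist I feasible = 1%E.
Proof. by apply: RD_dist1 => i; split => //=; rewrite in_itv /= position01. Qed.

Definition RD : mechanism R :=
  @Mechanism R (fun I => RD_dist I : probability _ _) RD_feasible.

End RD.

(* Main.v *)
(* Let j be the facility that RD uses for agents approving both facilities, S
   the number of agents approving j and b the number of the others, so that the
   latter approve only the other facility. For points x_i of [0, 1], m in number,
   and a point y of [0, 1] with D = sum_i |x_i - y|, one has
   sum_(i, k) |x_i - x_k| <= 2 D (m - D).
   Applied to the S agents and an optimal location y, so that W = S - D is the
   welfare, and to the b agents, where it gives at most b^2 / 2, it yields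
   n E >= W^2 + D^2 + b^2 / 2 for the expected welfare E of RD. The bound
   3 n E >= 2 n W = 2 (W + D + b) W then follows since
   W^2 + 3 D^2 + 3/2 b^2 - 2 D W - 2 b W =
   (W - 3 D)^2 / 3 + (3 b - 2 W)^2 / 6.
   Equality forces W = 3 D, 3 b = 2 W; six agents achieve it: facility 1 is
   approved at 1/2, 1/2, 0, 1 and facility 2 at 0, 1. *)

Require Import Defs.
From mathcomp Require Import all_boot all_order all_algebra.
From mathcomp Require Import all_classical all_reals all_analysis.
From mathcomp Require Import measurable_realfun.
From mathcomp Require Import ring lra.

Set Implicit Arguments.
Unset Strict Implicit.
Unset Printing Implicit Defensive.

Import Order.TTheory GRing.Theory Num.Theory.

Local Open Scope ring_scope.

(** * Pairwise distances between points of the unit interval *)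

(** Opposite signs give [|a| + |b|]; equal signs cancel twice the smaller modulus, which is the
    minimum of the positive or of the negative parts. *)
Lemma normrB_min_max (R : realDomainType) (a b : R) :
  `|a - b| = `|a| + `|b| - 2 * Num.min (Num.max a 0) (Num.max b 0) -
    2 * Num.min (Num.max (- a) 0) (Num.max (- b) 0).
Proof.
wlog ab : a b / b <= a => [hw|].
  have [|/ltW] := leP b a; first exact: hw.
  by move=> /hw; rewrite distrC (minC (Num.max b 0)) (minC (Num.max (- b) 0))
    (addrC `|b|).
rewrite (ger0_norm (x := a - b)) ?subr_ge0//.
rewrite (min_r (x := Num.max a 0)) ?ge_max ?le_max ?ab ?lexx ?orbT//.
rewrite (min_l (x := Num.max (- a) 0)) ?ge_max ?le_max ?lerN2 ?ab ?lexx ?orbT//.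
have [b0|b0] := ger0P b; have [a0|a0] := ger0P a;
  rewrite /Num.max
  ?oppr_lt0 ?oppr_gt0; case: ltP; case: ltP; lra.
Qed.

Section sums_of_distances.
Context {R : realFieldType} {T : finType} (P : pred T).
Implicit Types (f x : T -> R) (y D : R).

(* The bound is min(a, b) >= a b / y, then the tangent at c = y D of the
   convex function c |-> c^2 / y. *)
Lemma sum_min_ge f y D : 0 <= y -> (forall i, 0 <= f i <= y) ->
  2 * D * (\sum_(i | P i) f i) - y * D ^+ 2 <=
  \sum_(i | P i) \sum_(k | P k) Num.min (f i) (f k).
Proof.
move=> y0 fy; set a := \sum_(i | P i) f i.
have [y_gt0|y_le0] := ltP 0 y; last first.
  have f0 i : f i = 0 by have := fy i; lra.
  rewrite /a !big1 => [|i _|i _//]; first by nra.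
  by rewrite big1// => k _; rewrite !f0 minxx.
apply: (@le_trans _ _ (a ^+ 2 / y)).
  by rewrite ler_pdivlMr//; have := sqr_ge0 (a - y * D); nra.
rewrite expr2 big_distrlr/= mulr_suml; apply: ler_sum => i _.
rewrite mulr_suml; apply: ler_sum => k _.
rewrite ler_pdivrMr//.
by have := fy i; have := fy k; case: (leP (f i) (f k)) => ? ? ?; nra.
Qed.

(** The deviations from [y] split into left parts in [[0, y]] and right parts in [[0, 1 - y]], with
    total [D]. Using [sum_min_ge] with the same [D] on both sides, the minima sum to at least
    [2 D^2 - y D^2 - (1 - y) D^2 = D^2]. *)
Lemma sum_dist_le x y : 0 <= y <= 1 -> (forall i, 0 <= x i <= 1) ->
  \sum_(i | P i) \sum_(k | P k) `|x i - x k| <=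
  2 * (\sum_(i | P i) `|x i - y|) *
    (\sum_(i | P i) 1 - \sum_(i | P i) `|x i - y|).
Proof.
move=> y01 x01; set m := \sum_(i | P i) 1; set D := \sum_(i | P i) `|x i - y|.
pose r i := Num.max (x i - y) 0; pose l i := Num.max (- (x i - y)) 0.
have lP i : 0 <= l i <= y.
  by have := x01 i; rewrite /l; case: (leP (- (x i - y))); lra.
have rP i : 0 <= r i <= 1 - y.
  by have := x01 i; rewrite /r; case: (leP (x i - y)); lra.
have DE : D = \sum_(i | P i) l i + \sum_(i | P i) r i.
  rewrite /D -big_split; apply: eq_bigr => i _ /=.
  by rewrite /l /r; case: leP => ?; case: leP => ?; case: ger0P => ?; lra.
have distE i k : `|x i - x k| =
    `|x i - y| + `|x k - y| - 2 * Num.min (l i) (l k) - 2 * Num.min (r i) (r k).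
  have -> : x i - x k = (x i - y) - (x k - y) by ring.
  by rewrite normrB_min_max -/(r i) -/(r k) -/(l i) -/(l k); ring.
have -> : \sum_(i | P i) \sum_(k | P k) `|x i - x k| = 2 * D * m -
    2 * (\sum_(i | P i) \sum_(k | P k) Num.min (l i) (l k)) -
    2 * (\sum_(i | P i) \sum_(k | P k) Num.min (r i) (r k)).
  have -> : 2 * D * m = \sum_(i | P i) (`|x i - y| * m + D).
    have -> : 2 * D * m = D * m + D * m by ring.
    rewrite big_split/= -mulr_suml; congr (_ + _).
    by rewrite mulr_sumr; apply: eq_bigr => i _; rewrite mulr1.
  rewrite !mulr_sumr -!sumrB; apply: eq_bigr => i _.
  rewrite /m /D !mulr_sumr -big_split -!sumrB; apply: eq_bigr => k _ /=.
  by rewrite distE mulr1.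
have y1 : 0 <= 1 - y by lra.
have := sum_min_ge D (proj1 (andP y01)) lP; have := sum_min_ge D y1 rP.
move: DE; set a := \sum_(i | P i) l i; set c := \sum_(i | P i) r i => DE.
by rewrite {}DE; nra.
Qed.

End sums_of_distances.

(** * Expected welfare of RD and its lower bound *)

Section RD_welfare.
Context {R : realType} (opt : instance R -> facility).
Implicit Type I : instance R.

Lemma measurable_welfare I : measurable_fun setT (welfare I).
Proof.
apply: measurable_sum => i; apply: measurable_funM.
  by apply: (measurableT_comp (f := fun j : bool => (approves I i j)%:R : R)).
apply: measurable_funB => //.
apply: measurableT_comp => //; apply: measurable_funB => //.
Qed.

Lemma expected_welfare_RD I : expected_welfare (RD opt) I =
  (#|agent I|%:R^-1 * \sum_(i : agent I) welfare I (RD_outcome opt i))%:E.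
Proof.
rewrite /expected_welfare unlock.
have c_ge0 : 0 <= #|agent I|%:R^-1 :> R by rewrite invr_ge0.
pose c := NngNum c_ge0.
(* [msum] takes a family indexed by [nat], so agents are enumerated; the value [mzero] lies beyond
   the range of the sum. *)
pose o (k : nat) : {measure set (outcome R) -> \bar R} :=
  match insub k : option 'I_#|agent I| with
  | Some k => \d_(RD_outcome opt (enum_val k)) | None => mzero end.
have integral_RD (f : outcome R -> \bar R) : measurable_fun setT f ->
    (forall x, 0 <= f x)%E ->
    (\int[RD opt I]_x f x =
     c%:num%:E * \sum_(i : agent I) f (RD_outcome opt i))%E.
  move=> mf f0.
  rewrite (@eq_measure_integral _ _ _ _ (mscale c (msum o #|agent I|))); last first.
    move=> A mA _ /=; rewrite /RD_dist /mscale/= /msum; congr (_ * _)%E.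
    rewrite (reindex (@enum_val _ (agent I)))/=;
    last exact/onW_bij/enum_val_bij.
    by apply: eq_bigr => k _; rewrite /o valK.
  rewrite ge0_integral_mscale//; congr (_ * _)%E.
  rewrite ge0_integral_measure_sum//.
  rewrite (reindex (@enum_val _ (agent I)))/=;
    last exact/onW_bij/enum_val_bij.
  apply: eq_bigr => k _; rewrite /o valK integral_dirac// diracE.
  by rewrite in_setT mul1e.
have mW : measurable_fun setT (EFin \o welfare I).
  by apply/measurable_EFinP; exact: measurable_welfare.
(* Welfare may be negative at locations outside [[0, 1]], so its positive and negative parts are
   integrated separately. *)
rewrite integralE !integral_RD//; last 2 first.
  exact: measurable_funeneg.
  exact: measurable_funepos.
pose w (i : agent I) := welfare I (RD_outcome opt i).
rewrite (eq_bigr (fun i => (Num.max (w i) 0)%:E)); last first.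
  by move=> i _; rewrite funeposE EFin_max.
rewrite [X in (_ - _ * X)%E](eq_bigr (fun i => (Num.max (- w i) 0)%:E)); last first.
  by move=> i _; rewrite funenegE EFin_max.
rewrite !sumEFin -!EFinM -EFinB -mulrBr -sumrB; congr (_ * _)%:E.
apply: eq_bigr => i _; rewrite -/(w i) /Num.max.
by case: (ltP (w i)) => ?; case: (ltP (- w i)) => ?; lra.
Qed.

Lemma RD_outcome_approved I (i : agent I) : approves I i (opt I) ->
  RD_outcome opt i = (opt I, position I i).
Proof.
rewrite /RD_outcome; have := approves_some i; rewrite /facility1 /facility2.
by case: (opt I); case: (approves I i false); case: (approves I i true).
Qed.

Lemma RD_outcome_disapproved I (i : agent I) : ~~ approves I i (opt I) ->
  RD_outcome opt i = (~~ opt I, position I i).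
Proof.
rewrite /RD_outcome; have := approves_some i; rewrite /facility1 /facility2.
by case: (opt I); case: (approves I i false); case: (approves I i true).
Qed.

Lemma utility_ge0 I (i : agent I) (o : outcome R) :
  0 <= o.2 <= 1 -> 0 <= utility i o.
Proof.
move=> o01; rewrite /utility mulr_ge0// subr_ge0 ler_norml.
by have := position01 i; lra.
Qed.

Lemma RD_welfare_bound I (y : R) : 0 <= y <= 1 ->
  0 < \sum_(i : agent I) welfare I (RD_outcome opt i) /\
  2 * #|agent I|%:R * welfare I (opt I, y) <=
  3 * \sum_(i : agent I) welfare I (RD_outcome opt i).
Proof.
move=> y01.
pose P i := approves I i (opt I); pose x := position I.
pose Q i := ~~ P i.
have x01 i : 0 <= x i <= 1 := position01 i.
set g := \sum_i _; set W := welfare I _.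
pose S : R := \sum_(i | P i) 1; pose D := \sum_(i | P i) `|x i - y|.
pose b : R := \sum_(i | Q i) 1; pose B := \sum_(i | Q i) `|x i - y|.
have nE : #|agent I|%:R = S + b.
  by rewrite -sum1_card natr_sum (bigID P).
have n0 : 0 < S + b by rewrite -nE ltr0n agent_nonempty.
have WE : W = S - D.
  rewrite -sumrB /W /welfare (bigID P)/= [X in _ + X]big1 ?addr0.
    by apply: eq_bigr => i Pi; rewrite /utility/= -/(P i) Pi mul1r.
  by move=> i nPi; rewrite /utility/= -/(P i) (negbTE nPi) mul0r.
have pairsE (Z : pred (agent I)) : \sum_(i | Z i) \sum_(k | Z k) (1 - `|x i - x k|) =
    (\sum_(i | Z i) 1) ^+ 2 - \sum_(i | Z i) \sum_(k | Z k) `|x i - x k|.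
  rewrite expr2 big_distrr/= -sumrB; apply: eq_bigr => i Zi.
  by rewrite mulr1 -sumrB.
(* Only pairs within one class are kept; the dropped utilities are nonnegative. *)
have HP : \sum_(i | P i) \sum_(k | P k) (1 - `|x i - x k|) <=
    \sum_(i | P i) welfare I (RD_outcome opt i).
  apply: ler_sum => i Pi; rewrite RD_outcome_approved// /welfare [leRHS](bigID P)/=.
  rewrite ler_wpDr ?sumr_ge0// => [k _|]; first exact/utility_ge0/x01.
  by apply: ler_sum => k Pk; rewrite /utility/= -/(P k) Pk mul1r distrC.
have HQ : \sum_(i | Q i) \sum_(k | Q k) (1 - `|x i - x k|) <=
    \sum_(i | Q i) welfare I (RD_outcome opt i).
  apply: ler_sum => i Qi; rewrite RD_outcome_disapproved// /welfare [leRHS](bigID Q)/=.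
  rewrite ler_wpDr ?sumr_ge0// => [k _|]; first exact/utility_ge0/x01.
  apply: ler_sum => k Qk; rewrite /utility/=.
  have -> : approves I k (~~ opt I).
    have := approves_some k; move: Qk; rewrite /Q /P /facility1 /facility2.
    by case: (opt I); case: (approves I k true); case: (approves I k false).
  by rewrite mul1r distrC.
have := sum_dist_le P y01 x01; have := sum_dist_le Q y01 x01.
rewrite -/S -/D -/b -/B => dQ dP.
move: HP HQ; rewrite !pairsE -/S -/b => HP HQ.
have gE : g = \sum_(i | P i) welfare I (RD_outcome opt i) +
              \sum_(i | Q i) welfare I (RD_outcome opt i) by rewrite /g (bigID P).
(* Here [S^2 - 2 D (S - D) = W^2 + D^2], and [b^2 - 2 B (b - B)] exceeds [b^2 / 2] by
   [(b - 2 B)^2 / 2]. *)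
have g_ge : W ^+ 2 + D ^+ 2 + b ^+ 2 / 2 <= g.
  by rewrite gE WE; have := sqr_ge0 (b - 2 * B); nra.
split.
  apply: lt_le_trans g_ge.
  have [b0|b0] := eqVneq b 0.
    have : 0 < S ^+ 2 by rewrite exprn_gt0//; lra.
    by rewrite WE b0; have := sqr_ge0 (S - 2 * D); nra.
  have : 0 < b ^+ 2 by rewrite exprn_even_gt0.
  by have := sqr_ge0 W; have := sqr_ge0 D; lra.
rewrite nE.
have := sqr_ge0 (W - 3 * D); have := sqr_ge0 (3 * b - 2 * W).
have -> : S = W + D by lra.
by nra.
Qed.

End RD_welfare.

(** * The six-agent instance that forces the ratio 3/2 *)

Section tight_instance.
Context {R : realType}.

Definition tight_position (i : 'I_6) : R := nth 0 [:: 2^-1; 2^-1; 0; 1; 0; 1] i.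

(** As [facility1] is [false], the first four agents approve only facility 1 and the last two only
    facility 2, so RD acts alike for every [opt]. *)
Definition tight_approves (i : 'I_6) (j : facility) : bool := (i < 4)%N (+) j.

Lemma tight_position01 i : 0 <= tight_position i <= 1.
Proof.
rewrite /tight_position.
by case: i => -[|[|[|[|[|[|i]]]]]] // ? /=; apply/andP; split; lra.
Qed.

Lemma tight_approves_some i :
  tight_approves i facility1 || tight_approves i facility2.
Proof. by rewrite /tight_approves; case: (i < 4)%N. Qed.

Lemma tight_agent_nonempty : (0 < #|'I_6|)%N.
Proof. by rewrite card_ord. Qed.

Definition tight : instance R :=
  @Instance R 'I_6 tight_position tight_approves
    tight_agent_nonempty tight_position01 tight_approves_some.

Let normr_half : (`|2^-1 : R| = 2^-1) * (`|1 - 2^-1 : R| = 2^-1) *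
  (`|2^-1 - 1 : R| = 2^-1).
Proof. by split; [split|]; case: ger0P; lra. Qed.

(** Facility 1 at 1/2 yields [1 + 1 + 1/2 + 1/2]. *)
Lemma opt_welfare_tight_ge : 3 <= opt_welfare tight.
Proof.
have [w _ [_ Wmax]] := opt_welfareP tight.
have half01 : feasible (facility1, 2^-1 : measurableTypeR R).
  by split => //=; rewrite in_itv/=; apply/andP; split; lra.
apply: le_trans (Wmax _ half01).
rewrite /welfare /utility/= !big_ord_recl big_ord0/=.
rewrite /tight_position /tight_approves /facility1/=.
by rewrite subrr sub0r normrN normr0 !normr_half; lra.
Qed.

Lemma RD_outcome_tight opt (i : agent tight) :
  RD_outcome opt i = (~~ (i < 4)%N, tight_position i).
Proof. by rewrite /RD_outcome/= /tight_approves; case: (i < 4)%N. Qed.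

(** In the order of the agents, the welfares are [3 + 3 + 2 + 2 + 1 + 1]. *)
Lemma welfare_RD_tight opt :
  \sum_(i : agent tight) welfare tight (RD_outcome opt i) = 12.
Proof.
under eq_bigr do rewrite RD_outcome_tight.
rewrite /welfare /utility/= !big_ord_recl !big_ord0/=.
rewrite /tight_position /tight_approves/=.
by rewrite !(subrr, sub0r, subr0, normrN, normr0, normr1, normr_half); lra.
Qed.

End tight_instance.

Theorem theorem5p6 (R : realType) (opt : instance R -> facility)
    (hopt : forall I : instance R, optimal_facility I (opt I)) :
  approximation_ratio (RD opt) = (3 / 2)%:E.
Proof.
have y01 : 0 <= (0 : R) <= 1 by rewrite lexx ler01.
(* Positivity of the expected welfare rules out the value [+oo] of the inverse at 0, leaving a real
   quotient. *)
have ratioE I : ((opt_welfare I)%:E / expected_welfare (RD opt) I)%E =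
    (opt_welfare I * #|agent I|%:R /
     \sum_(i : agent I) welfare I (RD_outcome opt i))%:E.
  have [g0 _] := RD_welfare_bound opt I y01.
  have n0 : 0 < #|agent I|%:R :> R by rewrite ltr0n agent_nonempty.
  rewrite expected_welfare_RD inver mulf_eq0 invr_eq0 !gt_eqF//=.
  by rewrite -EFinM invfM invrK mulrA.
apply/eqP; rewrite eq_le; apply/andP; split.
  apply: ge_ereal_sup => _ [I ->]; rewrite ratioE lee_fin.
  have [y [{}y01 WE _]] := facility_welfareP I (opt I).
  have [g0 bound] := RD_welfare_bound opt I y01.
  rewrite ler_pdivrMr// -(hopt I) -WE; lra.
(* The ratio on [tight] is at least [3 * 6 / 12]. *)
apply: le_trans (ereal_sup_ubound _); last by exists tight.
rewrite ratioE lee_fin.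
have [g0 _] := RD_welfare_bound opt tight y01.
rewrite ler_pdivlMr//.
rewrite welfare_RD_tight [#|_|]card_ord.
by have := opt_welfare_tight_ge (R := R); lra.
Qed.
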